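(* Let $n\geq 2$, let $t$ be an indeterminate, and let $f(t)\in\mathbb{Z}[t^{\pm1}]$ be invertible. The representation $\eta_2:T_n\rightarrow\mathrm{GL}_n(\mathbb{Z}[t^{\pm1}])$ of the twin group $T_n$ given, for $1\leq i\leq n-1$, by $$\eta_2(s_i)=\left(\begin{array}{c|c|c} I_{i-1} & 0 & 0\\ \hline 0 & \begin{matrix}0 & f(t)\\ f(t)^{-1} & 0\end{matrix} & 0\\ \hline 0&0&I_{n-i-1}\end{array}\right)$$ is reducible.
   Context: For $n\geq 2$, the twin group $T_n$ is the group with generators $s_1,\ldots,s_{n-1}$ and defining relations $s_i^2=1$ for $1\leq i\leq n-1$, and $s_is_j=s_js_i$ for $|i-j|\geq 2$. $I_r$ is the $r\times r$ identity matrix. Matrices act on column vectors. A representation into $\mathrm{GL}_n(\mathbb{Z}[t^{\pm1}])$ is called reducible if, acting on $\mathbb{Q}(t)^n$, it has an invariant subspace that is neither $0$ nor the whole space. *)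

(* Defs.v *)
From HB Require Import structures.
From mathcomp Require Import all_boot all_order all_algebra.
From mathcomp Require Import boolp.

Set Implicit Arguments.
Unset Strict Implicit.
Unset Printing Implicit Defensive.

Import GRing.Theory.
Local Open Scope ring_scope.
Local Open Scope quotient_scope.

Section Presentation.
Variable X : choiceType.

(* The letter (x, false) stands for x and (x, true) for its inverse. *)
Definition word := seq (X * bool).

Definition inv_word (w : word) : word := rev [seq (a.1, ~~ a.2) | a <- w].

Variable rel : word -> word -> Prop.

(* The least congruence containing [rel] and free cancellation. *)
Inductive word_cong : word -> word -> Prop :=
| WcRefl u : word_cong u u
| WcSym u v : word_cong u v -> word_cong v u
| WcTrans u v w : word_cong u v -> word_cong v w -> word_cong u w
| WcCat u u' v v' : word_cong u u' -> word_cong v v' ->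
    word_cong (u ++ v) (u' ++ v')
| WcCancel x b : word_cong [:: (x, b); (x, ~~ b)] [::]
| WcRel u v : rel u v -> word_cong u v.

Lemma word_cong_invl w : word_cong (inv_word w ++ w) [::].
Proof.
elim: w => [|[x b] w IH]; first exact: WcRefl.
rewrite /inv_word /= rev_cons cat_rcons -/(inv_word w).
apply: WcTrans IH; apply: WcCat; first exact: WcRefl.
rewrite -[in X in word_cong _ X](cat0s w) -[_ :: _]/([:: _; _] ++ w).
apply: WcCat; last exact: WcRefl.
by have := WcCancel x (~~ b); rewrite negbK.
Qed.

Lemma inv_wordK : involutive inv_word.
Proof.
move=> w; rewrite /inv_word map_rev revK -map_comp -[RHS]map_id.
by apply: eq_map => -[x b] /=; rewrite negbK.
Qed.

Lemma inv_word_cat u v : inv_word (u ++ v) = inv_word v ++ inv_word u.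
Proof. by rewrite /inv_word map_cat rev_cat. Qed.

Lemma word_cong_invr w : word_cong (w ++ inv_word w) [::].
Proof. by have := word_cong_invl (inv_word w); rewrite inv_wordK. Qed.

Lemma word_cong_inv u v : word_cong u v -> word_cong (inv_word u) (inv_word v).
Proof.
move=> uv.
have h1 : word_cong (inv_word u) (inv_word u ++ (v ++ inv_word v)).
  rewrite -{1}[inv_word u]cats0; apply: WcCat; first exact: WcRefl.
  exact/WcSym/word_cong_invr.
apply: WcTrans h1 _; rewrite catA -[X in word_cong _ X]cat0s.
apply: WcCat; last exact: WcRefl.
apply: WcTrans (word_cong_invl u).
by apply: WcCat; [exact: WcRefl | exact: WcSym].
Qed.

Definition word_eqb (u v : word) := `[< word_cong u v >].

Lemma word_eqb_refl : reflexive word_eqb.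
Proof. by move=> u; apply/asboolP; exact: WcRefl. Qed.

Lemma word_eqb_sym : symmetric word_eqb.
Proof. by move=> u v; apply/asboolP/asboolP; exact: WcSym. Qed.

Lemma word_eqb_trans : transitive word_eqb.
Proof.
by move=> v u w /asboolP uv /asboolP vw; apply/asboolP; exact: WcTrans vw.
Qed.

Canonical word_equiv :=
  EquivRel word_eqb word_eqb_refl word_eqb_sym word_eqb_trans.

Definition presented := {eq_quot word_equiv}.

HB.instance Definition _ := Choice.on presented.
HB.instance Definition _ := EqQuotient.on presented.

Definition presented_of_word (w : word) : presented := \pi_presented w.

Lemma presented_eqP (u v : word) :
  presented_of_word u = presented_of_word v <-> word_cong u v.
Proof. by split=> [/eqquotP/asboolP | /asboolP uv] //; apply/eqquotP. Qed.

Lemma presented_reprK (g : presented) : presented_of_word (repr g) = g.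
Proof. exact: reprK. Qed.

Lemma presented_repr_cong (w : word) : word_cong (repr (presented_of_word w)) w.
Proof. by apply/presented_eqP; rewrite presented_reprK. Qed.

Definition presented_one : presented := presented_of_word [::].
Definition presented_mul (g h : presented) : presented :=
  presented_of_word (repr g ++ repr h).
Definition presented_inv (g : presented) : presented :=
  presented_of_word (inv_word (repr g)).

Lemma presented_mulA : associative presented_mul.
Proof.
move=> g h k; apply/presented_eqP.
apply: (@WcTrans _ (repr g ++ (repr h ++ repr k))).
  by apply: WcCat; [exact: WcRefl | exact: presented_repr_cong].
rewrite catA; apply: WcCat; last exact: WcRefl.
exact/WcSym/presented_repr_cong.
Qed.

Lemma presented_mul1g : left_id presented_one presented_mul.
Proof.
move=> g; rewrite -[RHS]presented_reprK; apply/presented_eqP.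
rewrite -[X in word_cong _ X]cat0s.
by apply: WcCat; [exact: presented_repr_cong | exact: WcRefl].
Qed.

Lemma presented_mulg1 : right_id presented_one presented_mul.
Proof.
move=> g; rewrite -[RHS]presented_reprK; apply/presented_eqP.
rewrite -[X in word_cong _ X]cats0.
by apply: WcCat; [exact: WcRefl | exact: presented_repr_cong].
Qed.

Lemma presented_mulVg : left_inverse presented_one presented_inv presented_mul.
Proof.
move=> g; apply/presented_eqP; apply: WcTrans (word_cong_invl (repr g)).
by apply: WcCat; [exact: presented_repr_cong | exact: WcRefl].
Qed.

Lemma presented_mulgV : right_inverse presented_one presented_inv presented_mul.
Proof.
move=> g; apply/presented_eqP; apply: WcTrans (word_cong_invr (repr g)).
by apply: WcCat; [exact: WcRefl | exact: presented_repr_cong].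
Qed.

HB.instance Definition _ := isGroup.Build presented presented_mulA
  presented_mul1g presented_mulg1 presented_mulVg presented_mulgV.

Definition presented_gen (x : X) : presented := presented_of_word [:: (x, false)].

End Presentation.

(* Generators are numbered from 0: the index i : 'I_n.-1 stands for the
   generator usually written s_(i+1). *)
Variant twin_rel (n : nat) : word 'I_n.-1 -> word 'I_n.-1 -> Prop :=
| TwinInvol (i : 'I_n.-1) : twin_rel [:: (i, false); (i, false)] [::]
| TwinComm (i j : 'I_n.-1) : (i.+2 <= j)%N || (j.+2 <= i)%N ->
    twin_rel [:: (i, false); (j, false)] [:: (j, false); (i, false)].

Definition twin (n : nat) : groupType := presented (@twin_rel n).

Definition twin_gen (n : nat) (i : 'I_n.-1) : twin n :=
  presented_gen (@twin_rel n) i.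

Section GL.
Variables (R : comUnitRingType) (n : nat).

Record GL := MkGL { GLmx :> 'M[R]_n; GLmx_unit : GLmx \in unitmx }.

HB.instance Definition _ := [isSub for GLmx].
HB.instance Definition _ := [Choice of GL by <:].

Definition GL_one : GL := MkGL (unitmx1 R n).
Definition GL_mul (A B : GL) : GL.
Proof.
by exists (GLmx A *m GLmx B); rewrite unitmx_mul !GLmx_unit.
Defined.
Definition GL_inv (A : GL) : GL.
Proof. by exists (invmx A); rewrite unitmx_inv GLmx_unit. Defined.

Lemma GL_mulA : associative GL_mul.
Proof. by move=> A B C; apply: val_inj; exact: mulmxA. Qed.
Lemma GL_mul1g : left_id GL_one GL_mul.
Proof. by move=> A; apply: val_inj; exact: mul1mx. Qed.
Lemma GL_mulg1 : right_id GL_one GL_mul.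
Proof. by move=> A; apply: val_inj; exact: mulmx1. Qed.
Lemma GL_mulVg : left_inverse GL_one GL_inv GL_mul.
Proof. by move=> A; apply: val_inj; exact/mulVmx/GLmx_unit. Qed.
Lemma GL_mulgV : right_inverse GL_one GL_inv GL_mul.
Proof. by move=> A; apply: val_inj; exact/mulmxV/GLmx_unit. Qed.

HB.instance Definition _ := isGroup.Build GL
  GL_mulA GL_mul1g GL_mulg1 GL_mulVg GL_mulgV.

End GL.

Definition Qt : fieldType := {fraction {poly rat}}.

Definition Qt_t : Qt := tofrac 'X.

Definition Qt_of_Zt (p : {poly int}) : Qt := tofrac (map_poly intr p).

(* Z[t, 1/t] is realised as a subring of Q(t). *)
Definition is_laurent : {pred Qt} :=
  fun x => `[< exists p k, x = Qt_of_Zt p / Qt_t ^+ k >].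

Lemma Qt_t_neq0 : Qt_t != 0.
Proof. by rewrite /Qt_t tofrac_eq0 polyX_eq0. Qed.

Lemma is_laurent_subring : subring_closed is_laurent.
Proof.
have tU k : Qt_t ^+ k != 0 by rewrite expf_neq0 // Qt_t_neq0.
split.
- by apply/asboolP; exists 1, 0; rewrite /Qt_of_Zt !rmorph1 expr0 divr1.
- move=> _ _ /asboolP[p [k ->]] /asboolP[q [l ->]]; apply/asboolP.
  exists (p * 'X^l - q * 'X^k), (k + l)%N.
  rewrite /Qt_of_Zt !(rmorphB, rmorphM) /= !map_polyXn !tofracXn -/Qt_t.
  rewrite exprD mulrBl -!mulrA; congr (_ * _ - _ * _).
    by rewrite mulrC invfM -mulrA mulVf // mulr1.
  by rewrite invfM mulrA mulfV // mul1r.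
- move=> _ _ /asboolP[p [k ->]] /asboolP[q [l ->]]; apply/asboolP.
  exists (p * q), (k + l)%N.
  by rewrite /Qt_of_Zt !rmorphM /= exprD invfM mulrACA.
Qed.

HB.instance Definition _ := GRing.isSubringClosed.Build Qt is_laurent
  is_laurent_subring.

Record laurent := MkLaurent { Qt_of_laurent : Qt;
                              laurentP : Qt_of_laurent \in is_laurent }.

HB.instance Definition _ := [isSub for Qt_of_laurent].
HB.instance Definition _ := [Choice of laurent by <:].
HB.instance Definition _ := [SubChoice_isSubComNzRing of laurent by <:].

(* Being a unit of Z[t, 1/t] is not decided by the ambient field Q(t), where
   every nonzero element is invertible. *)
Definition laurent_unit : pred laurent := fun x => `[< exists y, y * x = 1 >].

Definition laurent_inv (x : laurent) : laurent :=
  if pselect (exists y, y * x = 1) is left h then projT1 (cid h) else x.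

Lemma laurent_mulVr : {in laurent_unit, left_inverse 1 laurent_inv *%R}.
Proof.
move=> x /asboolP ux; rewrite /laurent_inv.
by case: pselect => // h; case: cid.
Qed.

Lemma laurent_unitPl (x y : laurent) : y * x = 1 -> laurent_unit x.
Proof. by move=> yx; apply/asboolP; exists y. Qed.

Lemma laurent_invr_out : {in [predC laurent_unit], laurent_inv =1 id}.
Proof.
move=> x /negP ux; rewrite /laurent_inv.
by case: pselect => // h; case: ux; apply/asboolP.
Qed.

HB.instance Definition _ := GRing.ComNzRing_hasMulInverse.Build laurent
  laurent_mulVr laurent_unitPl laurent_invr_out.

(* Invariant subspaces are taken in the space of column vectors over Q(t). *)
Definition reducible (G : groupType) (n : nat)
    (rho : {multiplicative G -> GL laurent n}) : Prop :=
  exists U : {vspace 'cV[Qt]_n},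
    [/\ U != 0%VS, U != fullv &
        forall (g : G) (v : 'cV[Qt]_n), v \in U ->
          map_mx Qt_of_laurent (rho g) *m v \in U].

(* The identity matrix except for the 2 x 2 diagonal block [0, f; f^-1, 0]
   in rows and columns i, i+1, counted from 0. *)
Definition eta2_mx (n : nat) (f : laurent) (i : 'I_n.-1) : 'M[laurent]_n :=
  \matrix_(a < n, b < n)
    if (a == i :> nat) && (b == i.+1 :> nat) then f
    else if (a == i.+1 :> nat) && (b == i :> nat) then f^-1
    else if (a == b) && (a != i :> nat) && (a != i.+1 :> nat) then 1
    else 0.

(* Main.v *)
Require Import Defs.
From HB Require Import structures.
From mathcomp Require Import all_boot all_order all_algebra all_fingroup.
From mathcomp Require Import generic_quotient zify.

Set Implicit Arguments.
Unset Strict Implicit.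
Unset Printing Implicit Defensive.

Import GRing.Theory.
Local Open Scope ring_scope.

(** The matrices eta_2(s_i) are rescaled transpositions: with D the diagonal
    matrix of entries 1, f^-1, f^-2, ..., one has eta_2(s_i) = D P_i D^-1, where
    P_i is the permutation matrix exchanging the coordinates i and i+1
    ([eta2_mx_conj_perm]).  So eta_2 is, up to the change of basis D, the
    permutation representation of S_n pulled back along the morphism from T_n
    to S_n that sends generators to adjacent transpositions.  This morphism
    exists by the universal property of a presentation
    ([presented_universal]): transpositions are involutions, and those with
    disjoint supports commute.

    Permutation matrices fix the all-ones column, hence every eta_2(g) fixes
    the image of that column under D, which is (1, f^-1, f^-2, ...)
    ([conj_perm_mx_fixed], [eta2_fixed]).  The line that it spans is invariant,
    and it is a proper subspace since n >= 2 ([reducible_of_fixed_vector]). *)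

(** Between groups, compatibility with products forces h 1 = 1: cancel h 1 in
    h 1 * h 1 = h 1. *)
Lemma multiplicative1 (G H : groupType) (h : {multiplicative G -> H}) :
  h 1%g = 1%g.
Proof. by apply: (mulgI (h 1%g)); rewrite -gmulfM !mulg1. Qed.

Section PresentedGroup.
Variables (X : choiceType) (rel : word X -> word X -> Prop).

Section UniversalProperty.
Variables (G : groupType) (phi : X -> G).

Definition eval_word (w : word X) : G :=
  (\prod_(a <- w) if a.2 then (phi a.1)^-1 else phi a.1)%g.

Lemma eval_word_cat u v : eval_word (u ++ v) = (eval_word u * eval_word v)%g.
Proof. exact: big_cat. Qed.

Hypothesis phi_rel : forall u v, rel u v -> eval_word u = eval_word v.

Lemma eval_word_cong u v : word_cong rel u v -> eval_word u = eval_word v.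
Proof.
elim=> //.
- by move=> x y z _ -> _ ->.
- by move=> x x' y y' _ ux _ uy; rewrite !eval_word_cat ux uy.
- move=> x b; rewrite /eval_word big_cons big_seq1 big_nil /=.
  by case: b; rewrite /= (mulVg, mulgV).
Qed.

(** Evaluating a representative word is a morphism because evaluation is
    constant on classes of words. *)
Lemma presented_universal :
  exists h : {multiplicative presented rel -> G},
    forall x, h (presented_gen rel x) = phi x.
Proof.
pose h (g : presented rel) := eval_word (repr g).
have hM : {morph h : x y / (x * y)%g}.
  move=> x y; rewrite /h -eval_word_cat; apply: eval_word_cong.
  exact: presented_repr_cong.
pose hm : {multiplicative presented rel -> G} :=
  HB.pack h (isMultiplicative.Build _ _ h hM).
exists hm => x; rewrite /= /h (eval_word_cong (presented_repr_cong _ _)).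
by rewrite /eval_word big_seq1.
Qed.

End UniversalProperty.

Lemma presented_of_word_cat u v :
  presented_of_word rel (u ++ v) =
  (presented_of_word rel u * presented_of_word rel v)%g.
Proof.
by apply/presented_eqP; apply: WcCat; apply: WcSym; exact: presented_repr_cong.
Qed.

Lemma presented_of_letterV x :
  presented_of_word rel [:: (x, true)] = (presented_gen rel x)^-1%g.
Proof.
apply/esym/presented_eqP.
exact: (word_cong_inv (presented_repr_cong rel [:: (x, false)])).
Qed.

(** A presented group is generated by its letters: any property stable under
    the group operations can be checked on them. *)
Lemma presented_ind (P : presented rel -> Prop) :
  P 1%g -> (forall g h, P g -> P h -> P (g * h)%g) ->
  (forall g, P g -> P g^-1%g) -> (forall x, P (presented_gen rel x)) ->
  forall g, P g.
Proof.
move=> P1 PM PV Pgen g; rewrite -(presented_reprK g).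
elim: (repr g : word X) => [|[x b] w IHw]; first exact: P1.
rewrite -cat1s presented_of_word_cat; apply: PM => //.
by case: b; [rewrite presented_of_letterV; exact/PV/Pgen | exact: Pgen].
Qed.

End PresentedGroup.

Section ConjPerm.
Variables (R : comUnitRingType) (n : nat) (f : R).

Definition pow_diag (x : R) : 'M[R]_n := diag_mx (\row_k x ^+ k).

Definition conj_perm_mx (s : 'S_n) : 'M[R]_n :=
  pow_diag f^-1 *m perm_mx s *m pow_diag f.

Definition pow_col : 'cV[R]_n := \col_k f^-1 ^+ k.

Lemma conj_perm_mxE s a b :
  conj_perm_mx s a b = f^-1 ^+ a * (s a == b)%:R * f ^+ b.
Proof. by rewrite /conj_perm_mx mul_diag_mx mul_mx_diag !mxE. Qed.

Hypothesis f_unit : f \is a GRing.unit.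

Lemma expr_invK k : f ^+ k * f^-1 ^+ k = 1.
Proof. by rewrite -exprMn divrr // expr1n. Qed.

Lemma pow_diagK : pow_diag f *m pow_diag f^-1 = 1%:M.
Proof.
rewrite mulmx_diag -diag_const_mx; congr diag_mx.
by apply/rowP => k; rewrite !mxE expr_invK.
Qed.

Lemma conj_perm_mx1 : conj_perm_mx 1%g = 1%:M.
Proof. by rewrite /conj_perm_mx perm_mx1 mulmx1; exact/mulmx1C/pow_diagK. Qed.

Lemma conj_perm_mxM s t :
  conj_perm_mx (s * t)%g = conj_perm_mx s *m conj_perm_mx t.
Proof.
rewrite /conj_perm_mx perm_mxM !mulmxA.
by rewrite -[in RHS](mulmxA _ (pow_diag f)) pow_diagK mulmx1.
Qed.

Lemma conj_perm_mx_unit s : conj_perm_mx s \in unitmx.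
Proof.
by apply: (mulmx1_unit (B := conj_perm_mx s^-1) _).1;
  rewrite -conj_perm_mxM mulgV conj_perm_mx1.
Qed.

Definition conj_perm (s : 'S_n) : GL R n := MkGL (conj_perm_mx_unit s).

Lemma conj_perm1 : conj_perm 1%g = 1%g.
Proof. by apply: val_inj; exact: conj_perm_mx1. Qed.

Lemma conj_permM s t : conj_perm (s * t)%g = (conj_perm s * conj_perm t)%g.
Proof. by apply: val_inj; exact: conj_perm_mxM. Qed.

(** Row a has a single nonzero entry, f^-a f^(s a) in column s a, which the
    entry f^-(s a) of the fixed column turns into f^-a. *)
Lemma conj_perm_mx_fixed s : conj_perm_mx s *m pow_col = pow_col.
Proof.
apply/colP => a; rewrite !mxE (bigD1 (s a)) //= big1 => [|b ba].
  by rewrite conj_perm_mxE !mxE eqxx mulr1 addr0 -mulrA expr_invK mulr1.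
by rewrite conj_perm_mxE eq_sym (negPf ba) mulr0 !mul0r.
Qed.

End ConjPerm.

(** The two lifts embed 'I_n in 'I_n.+1 as k and as k + 1, so that this is the
    transposition of i and i + 1. *)
Definition adj_tperm (n : nat) (i : 'I_n) : 'S_n.+1 :=
  tperm (lift ord_max i) (lift ord0 i).

Lemma val_lift_max (n : nat) (i : 'I_n) : lift ord_max i = i :> nat.
Proof. by rewrite /= /bump leqNgt ltn_ord. Qed.

Lemma val_lift0 (n : nat) (i : 'I_n) : lift ord0 i = i.+1 :> nat.
Proof. by []. Qed.

Lemma adj_tpermC (n : nat) (i j : 'I_n) : (i.+2 <= j)%N || (j.+2 <= i)%N ->
  commute (adj_tperm i) (adj_tperm j).
Proof.
move=> ij; apply/commgP/conjg_fixP; rewrite tpermJ.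
by congr tperm; apply: tpermD; apply/eqP => /(congr1 (@nat_of_ord _));
  rewrite ?val_lift_max ?val_lift0; lia.
Qed.

(** Conjugating by D multiplies the entry (a, b) by f^(b - a), which is f at
    (i, i+1), f^-1 at (i+1, i), and 1 on the diagonal. *)
Lemma eta2_mx_conj_perm (n : nat) (f : laurent) (i : 'I_n) :
  f \is a GRing.unit -> @eta2_mx n.+1 f i = conj_perm_mx f (adj_tperm i).
Proof.
move=> f_unit; apply/matrixP => a b; rewrite conj_perm_mxE mxE /adj_tperm.
have fK k : f^-1 ^+ k * f ^+ k = 1 by rewrite mulrC expr_invK.
have ordE (x y : 'I_n.+1) : (x == y) = (x == y :> nat) by [].
have [iF iF'] : (i == i.+1 :> nat) = false /\ (i.+1 == i :> nat) = false.
  by split; apply/eqP; lia.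
case: tpermP => [->|->|ai aj]; rewrite !ordE ?val_lift_max ?val_lift0.
- rewrite eqxx iF !andbF /= [i.+1 == b :> nat]eq_sym.
  case: eqP => [->|_]; last by rewrite mulr0 mul0r.
  by rewrite mulr1 exprS mulrCA fK mulr1.
- rewrite eqxx iF' !andbF /= [i == b :> nat]eq_sym.
  case: eqP => [->|_]; last by rewrite mulr0 mul0r.
  by rewrite mulr1 exprS -mulrA fK mulr1.
- have -> : (a == i :> nat) = false.
    by apply/eqP; rewrite -(val_lift_max i) => /val_inj.
  have -> : (a == i.+1 :> nat) = false.
    by apply/eqP; rewrite -(val_lift0 i) => /val_inj.
  rewrite !andbT /=; case: eqP => [->|_]; last by rewrite mulr0 mul0r.
  by rewrite mulr1 fK.
Qed.

Lemma eta2_exists (n : nat) (f : laurent) : f \is a GRing.unit ->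
  exists eta2 : {multiplicative twin n.+1 -> GL laurent n.+1},
    forall i : 'I_n, GLmx (eta2 (@twin_gen n.+1 i)) = @eta2_mx n.+1 f i.
Proof.
move=> f_unit; pose phi (i : 'I_n) := conj_perm f_unit (adj_tperm i).
have phi_rel u v : @twin_rel n.+1 u v -> eval_word phi u = eval_word phi v.
  case=> [i|i j ij]; rewrite /eval_word !big_cons !big_nil !mulg1 -!conj_permM.
    by rewrite tperm2 conj_perm1.
  by rewrite adj_tpermC.
have [h hE] := presented_universal phi_rel.
by exists h => i; rewrite hE eta2_mx_conj_perm.
Qed.

(** The matrices fixing a given column form a group, so it is enough to look at
    the generators, which are rescaled permutation matrices. *)
Lemma eta2_fixed (n : nat) (f : laurent)
    (eta2 : {multiplicative twin n.+1 -> GL laurent n.+1}) :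
  f \is a GRing.unit ->
  (forall i : 'I_n, GLmx (eta2 (@twin_gen n.+1 i)) = @eta2_mx n.+1 f i) ->
  forall g, eta2 g *m pow_col n.+1 f = pow_col n.+1 f.
Proof.
move=> f_unit eta2E; elim/presented_ind.
- by rewrite multiplicative1 mul1mx.
- by move=> g h Pg Ph; rewrite gmulfM /= -mulmxA Ph Pg.
- (* Write the column as eta2 g applied to itself, then cancel. *)
  move=> g Pg; rewrite -{1}Pg mulmxA.
  have -> : eta2 g^-1%g *m eta2 g = eta2 (g^-1 * g)%g by rewrite gmulfM.
  by rewrite mulVg multiplicative1 mul1mx.
- by move=> i; rewrite eta2E eta2_mx_conj_perm // conj_perm_mx_fixed.
Qed.

(** A common fixed vector spans an invariant line, which is a proper subspace
    in dimension at least 2. *)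
Lemma reducible_of_fixed_vector (G : groupType) (n : nat)
    (rho : {multiplicative G -> GL laurent n}) (v : 'cV[laurent]_n) :
  (1 < n)%N -> v != 0 -> (forall g, rho g *m v = v) -> reducible rho.
Proof.
move=> n_gt1 v_neq0 v_fixed; pose u := map_mx Qt_of_laurent v.
exists <[u]>%VS; split.
- rewrite -dimv_eq0 dim_vline eqb0 negbK.
  apply: contra v_neq0 => /eqP u0; apply/eqP/matrixP => i j.
  have /matrixP/(_ i j) := u0; rewrite !mxE => u0ij.
  by apply: val_inj; rewrite /= u0ij.
- apply: contraTneq n_gt1 => uT; have := dim_vline u.
  by rewrite uT dimvf /dim /= muln1 => ->; case: (u != 0).
- move=> g _ /vlineP[k ->]; rewrite -scalemxAr memvZ //.
  have -> : map_mx Qt_of_laurent (rho g) *m u = u.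
    by rewrite /u -[in RHS](v_fixed g) (map_mxM (val : {rmorphism laurent -> Qt})).
  exact: memv_line.
Qed.

Theorem theorem16 (n : nat) (hn : (2 <= n)%N)
    (f : laurent) (hf : f \is a GRing.unit) :
  (exists eta2 : {multiplicative twin n -> GL laurent n},
     forall i : 'I_n.-1, GLmx (eta2 (twin_gen i)) = eta2_mx f i) /\
  (forall eta2 : {multiplicative twin n -> GL laurent n},
     (forall i : 'I_n.-1, GLmx (eta2 (twin_gen i)) = eta2_mx f i) ->
     reducible eta2).
Proof.
case: n hn => // n n_gt1; split=> [|eta2 eta2E]; first exact: eta2_exists.
apply: (reducible_of_fixed_vector (v := pow_col n.+1 f)) => //.
  (* Its top entry is f^-1 to the power 0, so it is nonzero for any f. *)
  by apply/eqP => /matrixP/(_ ord0 ord0)/eqP; rewrite !mxE expr0 oner_eq0.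
exact: eta2_fixed.
Qed.
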